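(* Fix integers $m_0\ge 1$ and $1\le m\le m_0$, and let $Z_n$ be the Zagreb index of the random network $U_n$. The variance of $Z_n$ satisfies $$\mathrm{Var}[Z_n]=4m^2(m+1)n+4m^2m_0(m_0-2m-1)\log^2 n+O(\log n).$$
   Context: The Zagreb index of a finite graph $G=(V,E)$ is $\sum_{v\in V}(\deg(v))^2$. The random network $U_n$ (with fixed integer parameters $m_0\ge1$, $1\le m\le m_0$) is defined as follows. At time $n=1$, $U_1$ is the complete graph on $m_0$ nodes (a single isolated node, with no self loop, if $m_0=1$). At each subsequent time $n\ge2$, a set of $m$ distinct nodes is chosen uniformly at random among all $m$-element subsets of the $n+m_0-2$ existing nodes (independently of the past given the current network), and a new node is added and joined to each of these $m$ nodes by one edge. Thus $U_n$ has $m_0+n-1$ nodes. $Z_n$ denotes the Zagreb index of $U_n$. The $O(\cdot)$ notation is as $n\to\infty$ with $m,m_0$ fixed. $\log^2 n$ means $(\log n)^2$. *)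

(* Defs.v *)
From HB Require Import structures.
From mathcomp Require Import all_boot all_order all_algebra.
From mathcomp Require Import all_classical all_reals all_analysis.

Set Implicit Arguments.
Unset Strict Implicit.
Unset Printing Implicit Defensive.

Import Order.TTheory GRing.Theory Num.Theory numFieldNormedType.Exports.

Local Open Scope classical_set_scope.
Local Open Scope ring_scope.

(* The adjacency relation is stored extensionally, so that the type of simple
   graphs on a finite vertex type is itself a finite type. *)
Record sgraph (V : finType) := SGraph {
  adjset :> {ffun V * V -> bool};
  adjset_simple :
    [forall x, ~~ adjset (x, x)] &&
    [forall x, forall y, adjset (x, y) == adjset (y, x)] }.

HB.instance Definition _ (V : finType) := [isSub for @adjset V].
HB.instance Definition _ (V : finType) := [Finite of sgraph V by <:].

Section Graphs.
Variable V : finType.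

Definition adj (G : sgraph V) (x y : V) : bool := G (x, y).

Definition deg (G : sgraph V) (v : V) : nat := #|[set w | adj G v w]%SET|.

Definition zagreb (G : sgraph V) : nat := (\sum_(v : V) deg G v ^ 2)%N.

Lemma complete_simple (f := [ffun p : V * V => p.1 != p.2]) :
  [forall x, ~~ f (x, x)] && [forall x, forall y, f (x, y) == f (y, x)].
Proof.
apply/andP; split; first by apply/forallP => x; rewrite ffunE /= eqxx.
by apply/forallP => x; apply/forallP => y; rewrite !ffunE /= (eq_sym x).
Qed.

Definition complete_graph : sgraph V := SGraph complete_simple.

End Graphs.

Section Attach.
Variable N : nat.

(* The old vertex i : 'I_N is identified with lift ord_max i : 'I_N.+1, which
   has the same value; the new vertex is ord_max. *)
Definition attach_rel (G : sgraph 'I_N) (A : {set 'I_N})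
    (p : 'I_N.+1 * 'I_N.+1) : bool :=
  match unlift ord_max p.1, unlift ord_max p.2 with
  | Some x, Some y => adj G x y
  | Some x, None => x \in A
  | None, Some y => y \in A
  | None, None => false
  end.

Lemma attach_simple G A (f := [ffun p => attach_rel G A p]) :
  [forall x, ~~ f (x, x)] && [forall x, forall y, f (x, y) == f (y, x)].
Proof.
have /andP[/forallP irr /forallP sym] := adjset_simple G.
apply/andP; split.
  apply/forallP => x; rewrite ffunE /attach_rel /=.
  by case: (unlift _ x) => // a; exact: irr.
apply/forallP => x; apply/forallP => y; rewrite !ffunE /attach_rel /=.
case: (unlift _ x) (unlift _ y) => [a|] [b|] //.
by have /forallP := sym a; exact.
Qed.

Definition attach (G : sgraph 'I_N) (A : {set 'I_N}) : sgraph 'I_N.+1 :=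
  SGraph (attach_simple G A).

End Attach.

(* Times are shifted by one: network s k is the network at time k + 1, on the
   k + m0 nodes 'I_(k + m0), and s k is the set of existing nodes to which the
   node arriving at time k + 2 is joined. *)
Fixpoint network (m0 : nat) (s : forall k, {set 'I_(k + m0)}) (k : nat) :
    sgraph 'I_(k + m0) :=
  match k with
  | 0%N => complete_graph 'I_(0 + m0)
  | k'.+1 => attach (network s k') (s k')
  end.

Section RandomNetwork.
Context {d : measure_display} {T : measurableType d} {R : realType}.
Variables (P : probability T R) (m0 m : nat).
Variable S : forall k, T -> {set 'I_(k + m0)}.

(* U n is meant for n >= 1 only. *)
Definition U (n : nat) (w : T) : sgraph 'I_(n.-1 + m0) :=
  network (fun k => S k w) n.-1.

Definition Z (n : nat) (w : T) : R := (zagreb (U n w))%:R.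

(* The last clause says that, conditionally on any history g of the network up
   to time k + 1, the set S k is uniform among the m-element sets of nodes; it
   is written as a product so that histories of probability 0 need no separate
   treatment. *)
Definition uniform_attachment : Prop :=
  [/\ forall k A, measurable (S k @^-1` [set A]),
      forall k w, #|S k w| = m
    & forall k (g : forall j, sgraph 'I_(j + m0)) (A : {set 'I_(k + m0)}),
        #|A| = m ->
        let history :=
          [set w | forall j, (j <= k)%N -> U j.+1 w = g j] in
        P (S k @^-1` [set A] `&` history) =
        (('C(k + m0, m)%:R^-1)%:E * P history)%E].

End RandomNetwork.

(* Main.v *)
Require Import Defs.
From mathcomp Require Import all_boot all_order all_algebra perm.
From mathcomp Require Import all_classical all_reals all_analysis.
From mathcomp Require Import ring lra zify.

Set Implicit Arguments.
Unset Strict Implicit.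
Unset Printing Implicit Defensive.

Import Order.TTheory GRing.Theory Num.Theory numFieldNormedType.Exports.

Local Open Scope classical_set_scope.
Local Open Scope ring_scope.

(* When a node is attached to a uniform m-set A of the N existing nodes, the
   Zagreb index grows by 2 (sum of the degrees over A) + m + m^2. The total degree
   D = 2mN + c, where c = m0 (m0 - 2m - 1), is deterministic, so the conditional
   mean of this increment is too, and the centered Zagreb index is a martingale.
   Its variance therefore grows by four times the expected variance of the sampled
   degree sum, which is m (N - m) / (N (N - 1)) * (E Z - D^2 / N) by the formula
   for sampling without replacement. Summing the means gives
   E Z - D^2 / N = m (m + 1) N + 2mc ln N + O(1), so the variance increments are
   4m^2 (m + 1) + 8m^2 c ln N / N + O(1 / N), whose sum is the claimed expansion. *)

(** * Degrees and the Zagreb index under attachment of a node *)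

Lemma degE (V : finType) (G : sgraph V) v : deg G v = (\sum_w adj G v w)%N.
Proof. by rewrite /deg -sum1dep_card big_mkcond. Qed.

Lemma deg_complete n v : deg (complete_graph 'I_n) v = n.-1.
Proof.
rewrite /deg -[in RHS](card_ord n) [in RHS](cardD1 v) inE add1n /=.
by apply: eq_card => w; rewrite !inE /adj /= ffunE /= eq_sym andbT.
Qed.

Section Attach.
Variables (N : nat) (G : sgraph 'I_N) (A : {set 'I_N}).

Lemma adj_attach_old v w :
  adj (attach G A) (lift ord_max v) (lift ord_max w) = adj G v w.
Proof. by rewrite /adj /= ffunE /attach_rel /= !liftK. Qed.

Lemma adj_attach_new v : adj (attach G A) ord_max (lift ord_max v) = (v \in A).
Proof. by rewrite /adj /= ffunE /attach_rel /= liftK unlift_none. Qed.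

Lemma adj_attach_newC v : adj (attach G A) (lift ord_max v) ord_max = (v \in A).
Proof. by rewrite /adj /= ffunE /attach_rel /= liftK unlift_none. Qed.

Lemma adj_attach_loop : adj (attach G A) ord_max ord_max = false.
Proof. by rewrite /adj /= ffunE /attach_rel /= unlift_none. Qed.

Lemma deg_attach_old v :
  deg (attach G A) (lift ord_max v) = (deg G v + (v \in A))%N.
Proof.
rewrite !degE (bigD1_ord ord_max)//= adj_attach_newC addnC; congr addn.
by apply: eq_bigr => w _; rewrite adj_attach_old.
Qed.

Lemma deg_attach_new : deg (attach G A) ord_max = #|A|.
Proof.
rewrite degE (bigD1_ord ord_max)//= adj_attach_loop add0n -sum1_card [RHS]big_mkcond.
by apply: eq_bigr => w _; rewrite adj_attach_new.
Qed.

Lemma sum_deg_attach :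
  (\sum_v deg (attach G A) v = \sum_v deg G v + #|A|.*2)%N.
Proof.
rewrite (bigD1_ord ord_max)//= deg_attach_new -addnn addnCA; congr addn.
under eq_bigr do rewrite deg_attach_old.
by rewrite big_split /= -sum1_card [in RHS](big_mkcond (mem A)).
Qed.

Lemma zagreb_attach :
  (zagreb (attach G A) =
   zagreb G + (\sum_(v in A) deg G v).*2 + #|A| + #|A| ^ 2)%N.
Proof.
rewrite /zagreb (bigD1_ord ord_max)//= deg_attach_new addnC; congr addn.
under eq_bigr do rewrite deg_attach_old.
rewrite -sum1_card !(big_mkcond (mem A)) -mul2n big_distrr -!big_split /=.
by apply: eq_bigr => v _; case: (v \in A); rewrite ?addn0 // -!mulnn; nia.
Qed.

End Attach.

(** Attaching changes no adjacency between old nodes, so the old graph can be read off the new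
    one. *)
Lemma attach_injl N (G G' : sgraph 'I_N) A A' :
  attach G A = attach G' A' -> G = G'.
Proof.
move=> e; apply/val_inj/ffunP => -[v w].
by have := adj_attach_old G A v w; rewrite e adj_attach_old.
Qed.

(** * Sampling without replacement *)

Section Sampling.
Variables (R : numFieldType) (V : finType) (m : nat).

(** Unnormalized joint inclusion probability of [v] and [w] in a uniform m-set. *)
Definition cover2 (v w : V) : R :=
  \sum_(A : {set V} | #|A| == m) ((v \in A) && (w \in A))%:R.

(* Invariance under permutations leaves one diagonal and one off-diagonal value,
   and double counting determines both. *)
Lemma cover2_perm (s : {perm V}) v w : cover2 (s v) (s w) = cover2 v w.
Proof.
rewrite /cover2 (reindex_inj (imset_inj (@perm_inj _ s))) /=.
apply: eq_big => [A|A _]; first by rewrite card_imset //; exact: perm_inj.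
by rewrite !mem_imset //; exact: perm_inj.
Qed.

(** Each m-set containing [v] is counted once for each of its m elements. *)
Lemma sum_cover2 v : \sum_w cover2 v w = m%:R * cover2 v v.
Proof.
rewrite exchange_big big_distrr /=; apply: eq_bigr => A /eqP cA.
rewrite andbb; case: (v \in A); last by rewrite mulr0 big1.
rewrite mulr1 -cA -sum1_card natr_sum [in RHS]big_mkcond.
by apply: eq_bigr => w _; case: (w \in A).
Qed.

Lemma cover2_diag v : #|V|%:R * cover2 v v = m%:R * 'C(#|V|, m)%:R.
Proof.
transitivity (\sum_w cover2 w w).
  rewrite mulr_natl -[#|V|]sum1_card -sumrMnr; apply: eq_bigr => w _.
  by rewrite mulr1n -(cover2_perm (tperm v w)) tpermL.
rewrite exchange_big /= -(card_draws V m) -sum1dep_card natr_sum big_distrr /=.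
apply: eq_bigr => A /eqP cA; rewrite -cA mulr1 -sum1_card natr_sum [in RHS]big_mkcond.
by apply: eq_bigr => w _; rewrite andbb; case: (w \in A).
Qed.

Lemma cover2_offdiag v w : v != w ->
  (#|V|%:R - 1) * cover2 v w = (m%:R - 1) * cover2 v v.
Proof.
move=> vw; rewrite [RHS]mulrBl mul1r -sum_cover2 (bigD1 v) //= addrAC subrr add0r.
rewrite -(@natrB _ _ 1); last by apply/card_gt0P; exists v.
have -> : (#|V| - 1)%N = #|[pred u | u != v]|.
  by rewrite (cardD1 v) inE add1n subn1 /=; apply: eq_card => u; rewrite !inE andbT.
rewrite mulr_natl -sumr_const; apply: eq_bigr => u uv.
rewrite -(cover2_perm (tperm w u)) tpermL tpermD //.
by rewrite eq_sym.
Qed.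

Variable b : V -> R.
Hypothesis b0 : \sum_v b v = 0.

Lemma sum_sample : \sum_(A : {set V} | #|A| == m) \sum_(v in A) b v = 0.
Proof.
under eq_bigr do rewrite big_mkcond /=.
rewrite exchange_big /=.
have [V0|/card_gt0P[v0 _]] := posnP #|V|.
  by rewrite big1 // => v; have := fintype0 v V0.
rewrite (eq_bigr (fun v => cover2 v0 v0 * b v)); last first.
  move=> v _; rewrite -(cover2_perm (tperm v0 v)) tpermL mulr_suml.
  apply: eq_bigr => A _; rewrite andbb.
  by case: (v \in A); rewrite ?mul1r ?mul0r.
by rewrite -mulr_sumr b0 mulr0.
Qed.

(** The square expands into a double sum weighted by [cover2]. As [b] sums to zero, only the sum of
    squares survives, times the diagonal value of [cover2] minus the off-diagonal one. *)
Lemma sum_sample_sqr :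
  \sum_(A : {set V} | #|A| == m) (\sum_(v in A) b v) ^+ 2 =
  'C(#|V|, m)%:R *
    (m%:R * (#|V|%:R - m%:R) / (#|V|%:R * (#|V|%:R - 1)) * \sum_v b v ^+ 2).
Proof.
transitivity (\sum_v \sum_w b v * b w * cover2 v w).
  under [RHS]eq_bigr => v _ do
    under eq_bigr => w _ do rewrite mulr_sumr.
  under [RHS]eq_bigr do rewrite exchange_big /=.
  rewrite [RHS]exchange_big /=; apply: eq_bigr => A _.
  rewrite big_mkcond expr2 mulr_suml; apply: eq_bigr => v _.
  rewrite mulr_sumr; apply: eq_bigr => w _.
  by case: (v \in A) (w \in A) => -[]; rewrite ?mulr1 ?mulr0 ?mul0r.
(* With at most one element the denominator vanishes, but so does [b]. *)
have [V1|V1] := leqP #|V| 1.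
  have bE v : b v = 0.
    rewrite -b0 (bigD1 v) //= big1 ?addr0 // => w wv.
    by have := fintype_le1P V1 v w => e; rewrite e eqxx in wv.
  rewrite !big1 ?mulr0 // => v _; first by rewrite bE expr0n.
  by rewrite big1 // => w _; rewrite bE !mul0r.
have N0 : (#|V|%:R : R) != 0 by rewrite pnatr_eq0; lia.
have N1 : (#|V|%:R - 1 : R) != 0 by rewrite subr_eq0 pnatr_eq1; lia.
pose c1 : R := m%:R * 'C(#|V|, m)%:R / #|V|%:R.
pose c2 : R := (m%:R - 1) * c1 / (#|V|%:R - 1).
have c1E v : cover2 v v = c1.
  by rewrite /c1 -(cover2_diag v) mulrAC divff // mul1r.
have c2E v w : v != w -> cover2 v w = c2.
  by move=> /cover2_offdiag e; rewrite /c2 -(c1E v) -e mulrAC divff // mul1r.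
transitivity (\sum_v (c2 * b v * \sum_w b w + (c1 - c2) * b v ^+ 2)).
  apply: eq_bigr => v _; rewrite mulr_sumr (bigD1 v) //= [in RHS](bigD1 v) //=.
  rewrite c1E addrAC; congr (_ + _); first by ring.
  by apply: eq_bigr => w wv; rewrite c2E 1?eq_sym //; ring.
rewrite b0; under eq_bigr do rewrite mulr0 add0r.
rewrite -mulr_sumr mulrA; congr (_ * _); rewrite /c2 /c1.
by field; rewrite N0 N1.
Qed.

End Sampling.

(** * Finite-valued random variables *)

Lemma preimage_pair (T I J : Type) (f : T -> I) (g : T -> J) i j :
  (fun w => (f w, g w)) @^-1` [set (i, j)] = f @^-1` [set i] `&` g @^-1` [set j].
Proof. by apply/seteqP; split => w /= [-> ->]. Qed.

Section FiniteValued.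
Context {d : measure_display} {T : measurableType d} {R : realType}.
Variables (P : probability T R) (I : finType) (Y : T -> I).
Hypothesis mY : forall i, measurable (Y @^-1` [set i]).

Lemma measurable_preimage_fin (B : set I) : measurable (Y @^-1` B).
Proof.
rewrite (_ : Y @^-1` B = \bigcup_(i in B) (Y @^-1` [set i])); last first.
  by rewrite -preimage_bigcup bigcup_imset1 image_id.
by apply: fin_bigcup_measurable => //; exact: finite_finset.
Qed.

Lemma expectation_fin (f : I -> R) :
  'E_P[fun w => f (Y w)]%E = (\sum_i fine (P (Y @^-1` [set i])) * f i)%:E.
Proof.
rewrite unlock.
transitivity (\int[P]_w (\sum_i (f i)%:E * (\1_(Y @^-1` [set i]) w)%:E))%E.
  apply: eq_integral => w _; rewrite (bigD1 (Y w)) //= big1 ?adde0.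
    by rewrite indicE mem_set // mule1.
  move=> i iY; rewrite indicE memNset ?mule0 //= => e.
  by rewrite e eqxx in iY.
rewrite integral_sum //; last first.
  by move=> i; apply: integrableZl => //; exact: integrable_indic.
rewrite -sumEFin; apply: eq_bigr => i _.
rewrite integralZl //; last exact: integrable_indic.
by rewrite integral_indic // setIT EFinM fineK ?fin_num_measure // muleC.
Qed.

End FiniteValued.

(** * The network as a Markov chain *)

Section Network.
Context {d : measure_display} {T : measurableType d} {R : realType}.
Variables (P : probability T R) (m0 m : nat).
Variable S : forall k, T -> {set 'I_(k + m0)}.
Hypothesis hm0 : (1 <= m0)%N.
Hypothesis hm : (m <= m0)%N.
Hypothesis hS : uniform_attachment P m S.

Let G k w : sgraph 'I_(k + m0) := network (fun j => S j w) k.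

Lemma network_past k w w' : G k w = G k w' ->
  forall j, (j <= k)%N -> G j w = G j w'.
Proof.
elim: k => [|k ih] e j; first by rewrite leqn0 => /eqP ->.
rewrite leq_eqVlt => /orP[/eqP -> //|]; rewrite ltnS; apply: ih.
exact: attach_injl e.
Qed.

Lemma measurable_set_fiber k A : measurable (S k @^-1` [set A]).
Proof. by case: hS. Qed.

Lemma card_set k w : #|S k w| = m.
Proof. by case: hS. Qed.

(** [G k.+1] is a function of the finite-valued pair [(G k, S k)], so its fibers are finite unions
    of fibers of that pair. *)
Lemma measurable_network k g : measurable (G k @^-1` [set g]).
Proof.
elim: k g => [|k ih] g.
  have -> : G 0 @^-1` [set g] = (fun _ => complete_graph _ = g) by [].
  have [e|e] := pselect (complete_graph 'I_(0 + m0) = g).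
    by rewrite (_ : (fun _ => _) = setT) //; apply/seteqP; split.
  by rewrite (_ : (fun _ => _) = set0) //; apply/seteqP; split.
apply: (@measurable_preimage_fin _ _ _ (fun w => (G k w, S k w)) _
  [set p | attach p.1 p.2 = g]) => -[g' A].
rewrite preimage_pair; apply: measurableI => //; exact: measurable_set_fiber.
Qed.

(* The network determines its past, so the history in uniform_attachment may be
   replaced by the current network. *)
Lemma uniform_given_network k g (A : {set 'I_(k + m0)}) : #|A| = m ->
  P (G k @^-1` [set g] `&` S k @^-1` [set A]) =
  (('C(k + m0, m)%:R^-1)%:E * P (G k @^-1` [set g]))%E.
Proof.
move=> cA; have [->|/set0P[w0 /= gE]] := eqVneq (G k @^-1` [set g]) set0.
  by rewrite set0I measure0 mule0.
have [_ _ /(_ k (fun j => G j w0) A cA) /=] := hS.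
rewrite setIC (_ : [set w | _] = G k @^-1` [set g]) //.
apply/seteqP; split => w /=; first by move=> /(_ k (leqnn k)); rewrite -gE.
by move=> e j; apply: (@network_past k); rewrite e gE.
Qed.

Definition law k (g : sgraph 'I_(k + m0)) : R :=
  fine (P (G k @^-1` [set g])).

Lemma expectation_network (k : nat) (f : sgraph 'I_(k + m0) -> R) :
  'E_P[fun w => f (G k w)]%E = (\sum_g law g * f g)%:E.
Proof. by apply: expectation_fin => g; exact: measurable_network. Qed.

Lemma sum_law k : \sum_(g : sgraph 'I_(k + m0)) law g = 1.
Proof.
have := @expectation_network k (fun _ => 1).
by rewrite (expectation_cst P 1) => -[->]; apply: eq_bigr => g _; rewrite mulr1.
Qed.

(** Transition rule of the chain: given the present network, the next set is uniform among the
    m-sets. *)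
Lemma law_step k (f : sgraph 'I_(k.+1 + m0) -> R) :
  \sum_g law g * f g =
  \sum_g law g *
    ('C(k + m0, m)%:R^-1 * \sum_(A : {set 'I_(k + m0)} | #|A| == m) f (attach g A)).
Proof.
apply: EFin_inj; rewrite -expectation_network.
rewrite (@expectation_fin _ _ _ P _ (fun w => (G k w, S k w)) _
  (fun p => f (attach p.1 p.2))) => [|[g A]]; last first.
  rewrite preimage_pair; apply: measurableI; first exact: measurable_network.
  exact: measurable_set_fiber.
congr EFin; transitivity (\sum_(g : sgraph 'I_(k + m0))
  \sum_(A : {set 'I_(k + m0)})
    fine (P (G k @^-1` [set g] `&` S k @^-1` [set A])) * f (attach g A)).
  by rewrite pair_bigA; apply: eq_bigr => -[g A] _; rewrite preimage_pair.
apply: eq_bigr => g _; rewrite !mulr_sumr (bigID (fun A : {set _} => #|A| == m)) /=.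
(* Sets of the wrong size are never drawn: their fibers are empty. *)
rewrite [X in _ + X]big1 ?addr0 => [|A /eqP cA]; last first.
  rewrite (_ : S k @^-1` [set A] = set0) ?setI0 ?measure0 ?mul0r //.
  by apply/seteqP; split => w //= e; apply: cA; rewrite -e card_set.
apply: eq_bigr => A /eqP cA; rewrite uniform_given_network //.
by rewrite fineM ?fin_num_measure //= /law; [ring|exact: measurable_network].
Qed.

Lemma sum_deg_network k w :
  (\sum_v deg (G k w) v = m0 * m0.-1 + (m * k).*2)%N.
Proof.
elim: k => [|k ih].
  by under eq_bigr do rewrite deg_complete; rewrite sum_nat_const card_ord; lia.
by rewrite sum_deg_attach card_set ih; lia.
Qed.

(** A graph of nonzero probability is attained at some outcome, where the degree sum is known. *)
Lemma sum_deg_law k (g : sgraph 'I_(k + m0)) : law g != 0 ->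
  (\sum_v deg g v = m0 * m0.-1 + (m * k).*2)%N.
Proof.
have [e|/set0P[w /= <-] _] := eqVneq (G k @^-1` [set g]) set0.
  by rewrite /law e measure0 eqxx.
exact: sum_deg_network.
Qed.

(** * Recursions for the mean and variance of the Zagreb index *)

Definition mean_zagreb k : R :=
  \sum_(g : sgraph 'I_(k + m0)) law g * (zagreb g)%:R.

Definition var_zagreb k : R :=
  \sum_(g : sgraph 'I_(k + m0)) law g * ((zagreb g)%:R - mean_zagreb k) ^+ 2.

Lemma variance_Z n : 'V_P[Z S n] = (var_zagreb n.-1)%:E.
Proof.
have ZE : Z S n = fun w => (zagreb (G n.-1 w))%:R :> R by [].
rewrite /variance unlock ZE.
rewrite (expectation_network (fun g => (zagreb g)%:R)) /=.
by rewrite -(expectation_network (fun g => ((zagreb g)%:R - _) ^+ 2)).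
Qed.

Definition total_deg k : R := (m0 * m0.-1 + (m * k).*2)%N%:R.

Lemma total_degE k :
  total_deg k =
  2 * m%:R * (k + m0)%:R + m0%:R * (m0%:R - 2 * m%:R - 1).
Proof.
rewrite /total_deg -[X in (_ * X)%N]subn1 -addnn !natrD !natrM natrB //.
by ring.
Qed.

Section Step.
Variables (k : nat) (g : sgraph 'I_(k + m0)).
Hypothesis lg : law g != 0.
Let N : R := (k + m0)%:R.
(** Deviations from the average degree; they sum to zero, as the sampling formulas require. *)
Let b v : R := (deg g v)%:R - total_deg k / N.
Let C : R := 'C(k + m0, m)%:R.

Let N_neq0 : N != 0.
Proof. by rewrite /N pnatr_eq0; lia. Qed.

Let C_neq0 : C != 0.
Proof. by rewrite /C pnatr_eq0 -lt0n bin_gt0; lia. Qed.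

Let sum_deg : \sum_v (deg g v)%:R = total_deg k :> R.
Proof. by rewrite -natr_sum (sum_deg_law lg). Qed.

Let sum_b : \sum_v b v = 0.
Proof.
rewrite sumrB sum_deg sumr_const card_ord -[_ *+ _]mulr_natl -/N.
by rewrite mulrCA divff // mulr1 subrr.
Qed.

Let sum_b_sqr : \sum_v b v ^+ 2 = (zagreb g)%:R - total_deg k ^+ 2 / N.
Proof.
pose a := total_deg k / N.
transitivity (\sum_v ((deg g v)%:R ^+ 2 - 2 * a * (deg g v)%:R + a ^+ 2)).
  by apply: eq_bigr => v _; rewrite /b -/a; ring.
rewrite big_split sumrB -mulr_sumr sum_deg sumr_const card_ord /=.
rewrite -[_ *+ _]mulr_natl -/N /zagreb natr_sum.
under [\sum_(i | _) ((_ ^ 2)%N)%:R]eq_bigr do rewrite natrX.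
by rewrite /a; field; rewrite -natrD.
Qed.

(** Separates the mean of the increment from its centered fluctuation. *)
Let zagreb_attachR (A : {set 'I_(k + m0)}) : #|A| == m ->
  (zagreb (attach g A))%:R = (zagreb g)%:R + 2 * m%:R * (total_deg k / N)
    + m%:R + m%:R ^+ 2 + 2 * \sum_(v in A) b v :> R.
Proof.
move=> /eqP cA; rewrite zagreb_attach cA sumrB sumr_const cA.
rewrite -addnn !natrD natrX natr_sum -[_ *+ m]mulr_natl.
by ring.
Qed.

Let sum_draws (x : R) : \sum_(A : {set 'I_(k + m0)} | #|A| == m) x = C * x.
Proof.
rewrite sumr_const -mulr_natl; congr (_%:R * _).
by rewrite -[in RHS](card_ord (k + m0)) -card_draws cardsE.
Qed.

Lemma mean_attach :
  C^-1 * \sum_(A : {set 'I_(k + m0)} | #|A| == m) (zagreb (attach g A))%:R =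
  (zagreb g)%:R + (2 * m%:R * (total_deg k / N) + m%:R + m%:R ^+ 2).
Proof.
rewrite (eq_bigr _ zagreb_attachR) big_split sum_draws -mulr_sumr /=.
by rewrite (sum_sample m sum_b) mulr0 addr0 mulKf //; ring.
Qed.

(** For [x] the present mean, the quantity subtracted on the left is the next mean. *)
Lemma var_attach (x : R) :
  C^-1 * \sum_(A : {set 'I_(k + m0)} | #|A| == m)
    ((zagreb (attach g A))%:R
      - (x + (2 * m%:R * (total_deg k / N) + m%:R + m%:R ^+ 2))) ^+ 2 =
  ((zagreb g)%:R - x) ^+ 2 +
  4 * m%:R * (N - m%:R) / (N * (N - 1)) *
    ((zagreb g)%:R - total_deg k ^+ 2 / N).
Proof.
pose y := (zagreb g)%:R - x.
transitivity (C^-1 * \sum_(A : {set 'I_(k + m0)} | #|A| == m)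
  (y ^+ 2 + 4 * y * \sum_(v in A) b v + 4 * (\sum_(v in A) b v) ^+ 2)).
  by congr (_ * _); apply: eq_bigr => A cA; rewrite zagreb_attachR // /y; ring.
rewrite !big_split sum_draws -!mulr_sumr /=.
rewrite (sum_sample m sum_b) (sum_sample_sqr m sum_b) sum_b_sqr card_ord -/C -/N.
rewrite /y mulr0 addr0 mulrDr mulKf //; congr (_ + _).
by rewrite mulrCA mulKf //; ring.
Qed.

End Step.

Lemma sum_lawDr k (f : sgraph 'I_(k + m0) -> R) (c : R) :
  \sum_g law g * (f g + c) = \sum_g law g * f g + c.
Proof.
under eq_bigr do rewrite mulrDr.
by rewrite big_split /= -mulr_suml sum_law mul1r.
Qed.

Lemma mean_zagreb_step k :
  mean_zagreb k.+1 =
  mean_zagreb k + (2 * m%:R * (total_deg k / (k + m0)%:R) + m%:R + m%:R ^+ 2).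
Proof.
rewrite /mean_zagreb (@law_step k (fun g => (zagreb g)%:R)) -sum_lawDr.
(* The degree sum is known only for graphs of nonzero probability. *)
apply: eq_bigr => g _; have [->|lg] := eqVneq (law g) 0; first by rewrite !mul0r.
by rewrite mean_attach.
Qed.

(* Given the present, the increment of the Zagreb index has constant mean, so the
   cross term vanishes and only the variance of the sampled degree sum is added.
   For N = 1 the quotient is 0 / 0 = 0, which is the correct value. *)
Lemma var_zagreb_step k (N := (k + m0)%:R : R) :
  var_zagreb k.+1 =
  var_zagreb k + 4 * m%:R * (N - m%:R) / (N * (N - 1)) *
    (mean_zagreb k - total_deg k ^+ 2 / N).
Proof.
have -> : mean_zagreb k - total_deg k ^+ 2 / N =
    \sum_(g : sgraph 'I_(k + m0))
      law g * ((zagreb g)%:R - total_deg k ^+ 2 / N).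
  by rewrite sum_lawDr.
rewrite /var_zagreb (@law_step k (fun g => ((zagreb g)%:R - _) ^+ 2)).
rewrite mulr_sumr -big_split /=; apply: eq_bigr => g _.
rewrite [X in _ = _ + X]mulrCA -mulrDr.
have [->|lg] := eqVneq (law g) 0; first by rewrite !mul0r.
by rewrite mean_zagreb_step var_attach.
Qed.

End Network.

(** * Asymptotics of the two recursions *)

Lemma ln_increment (R : realType) (x : R) : 0 < x ->
  (x + 1)^-1 <= ln (x + 1) - ln x <= x^-1.
Proof.
move=> x0; have x1 : 0 < x + 1 by lra.
have xV : 0 < x^-1 by rewrite invr_gt0.
have x1V : (x + 1)^-1 < 1 by rewrite invf_lt1 //; lra.
apply/andP; split.
  (* Both bounds are [ln (1 + t) <= t]: here with [t = - 1 / (x + 1)], below with [t = 1 / x]. *)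
  rewrite -opprB lerNr -ln_div ?posrE //.
  have -> : x / (x + 1) = 1 + - (x + 1)^-1 by field; lra.
  by apply: le_ln1Dx; lra.
rewrite -ln_div ?posrE //.
have -> : (x + 1) / x = 1 + x^-1 by field; lra.
by apply: le_ln1Dx; lra.
Qed.

(** Applied with [F] a multiple of [- 1 / N] for the mean and of [ln N] for the variance. *)
Lemma telescope_bound (R : realType) (h F : nat -> R) :
  (forall k, `|h k.+1 - h k| <= F k.+1 - F k) ->
  forall k, `|h k - h 0| <= F k - F 0.
Proof.
move=> hF; elim=> [|k ih]; first by rewrite !subrr normr0.
have -> : h k.+1 - h 0 = (h k.+1 - h k) + (h k - h 0) by ring.
by apply: le_trans (ler_normD _ _) _; have := hF k; lra.
Qed.

(* Here a = m and c = m0 (m0 - 2m - 1); index k stands for time k + 1. *)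
Section Asymptotics.
Variables (R : realType) (m0 : nat) (a c : R) (mu v : nat -> R).
Hypothesis hm0 : (1 <= m0)%N.
Hypothesis a_ge0 : 0 <= a.
Let N k : R := (k + m0)%:R.
Let D k : R := 2 * a * N k + c.
Hypothesis mu_step : forall k,
  mu k.+1 = mu k + (2 * a * (D k / N k) + a + a ^+ 2).
Hypothesis v_step : forall k,
  v k.+1 = v k + 4 * a * (N k - a) / (N k * (N k - 1)) *
    (mu k - D k ^+ 2 / N k).

Let C : R := `|c|.
Let C_ge0 : 0 <= C. Proof. exact: normr_ge0. Qed.

Let NS k : N k.+1 = N k + 1.
Proof. by rewrite /N addSn -natr1. Qed.

Let N_ge1 k : 1 <= N k.
Proof. by rewrite /N ler1n; lia. Qed.

Let NS_ge2 k : 2 <= N k.+1.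
Proof. by rewrite NS; have := N_ge1 k; lra. Qed.

(** The increment of [mu] is [5 a^2 + a + 2 a c / N], whose sum has these leading terms. *)
Let mean_err k := mu k - (5 * a ^+ 2 + a) * N k - 2 * a * c * ln (N k).

Lemma mean_err_bound k :
  `|mean_err k| <= `|mean_err 0| + 2 * a * C.
Proof.
have -> : mean_err k = (mean_err k - mean_err 0) + mean_err 0 by ring.
apply: le_trans (ler_normD _ _) _; rewrite addrC lerD2l.
(* The error increment is at most [2 a C (1 / N - 1 / (N + 1))], which telescopes. *)
apply: le_trans (_ : - (2 * a * C) / N k - - (2 * a * C) / N 0 <= _).
  move: k; apply: telescope_bound => k.
  have N1 := N_ge1 k; have /andP[d1 d2] := @ln_increment _ (N k) ltac:(lra).
  have -> : mean_err k.+1 - mean_err k =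
      2 * a * (c * ((N k)^-1 - (ln (N k + 1) - ln (N k)))).
    by rewrite /mean_err mu_step /D NS; field; lra.
  rewrite NS normrM ger0_norm ?mulr_ge0 // normrM -/C.
  rewrite [X in _ * (_ * X)]ger0_norm ?subr_ge0 //.
  have -> : - (2 * a * C) / (N k + 1) - - (2 * a * C) / N k =
      2 * a * (C * ((N k)^-1 - (N k + 1)^-1)) by field; lra.
  by apply: ler_wpM2l; rewrite ?mulr_ge0 //; apply: ler_wpM2l => //; lra.
have ac : 0 <= 2 * a * C by rewrite !mulr_ge0.
have V0 : (N 0)^-1 <= 1 by rewrite invf_le1 //; have := N_ge1 0; lra.
have Vk : 0 <= (N k)^-1 by rewrite invr_ge0; have := N_ge1 k; lra.
by rewrite mulNr mulNr opprK; nra.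
Qed.

(** For the network, this is the expected sum of squared deviations of the degrees from their
    average. *)
Let q k := mu k - D k ^+ 2 / N k.

(** Subtracting [D^2 / N = 4 a^2 N + 4 a c + c^2 / N] turns [5 a^2 + a] into [a^2 + a] and leaves a
    bounded remainder. *)
Lemma q_bound : exists2 K : R, 0 <= K &
  forall k, `|q k - (a ^+ 2 + a) * N k - 2 * a * c * ln (N k)| <= K.
Proof.
exists (`|mean_err 0| + 2 * a * C + (`|4 * a * c| + c ^+ 2)).
  by apply: addr_ge0; apply: addr_ge0; rewrite ?sqr_ge0 ?mulr_ge0.
move=> k; have N1 := N_ge1 k.
have -> : q k - (a ^+ 2 + a) * N k - 2 * a * c * ln (N k) =
    mean_err k - (4 * a * c + c ^+ 2 / N k).
  by rewrite /q /mean_err /D; field; lra.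
apply: le_trans (ler_normB _ _) _; apply: lerD; first exact: mean_err_bound.
apply: le_trans (ler_normD _ _) _; rewrite lerD2l ger0_norm.
  by rewrite ler_pdivrMr; [have := sqr_ge0 c; nra|lra].
by rewrite divr_ge0 ?sqr_ge0 //; lra.
Qed.

Let var_err k := v k - 4 * a ^+ 2 * (a + 1) * N k - 4 * a ^+ 2 * c * ln (N k) ^+ 2.

(* Starting at k.+1 ensures N >= 2, away from the junk value of 1 / (N - 1). *)
Lemma var_err_step : exists2 K : R, 0 <= K &
  forall k, `|var_err k.+2 - var_err k.+1| <= K * (ln (N k.+2) - ln (N k.+1)).
Proof.
have [K1 K1_ge0 qK1] := q_bound.
(* Chosen so that [K2 N] bounds [q], using [ln N <= N] and [N >= 1]. *)
pose K2 := a ^+ 2 + a + 2 * a * C + K1.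
have ac : 0 <= a * C by rewrite mulr_ge0.
have a0 := a_ge0.
have K2_ge0 : 0 <= K2 by rewrite /K2; have := sqr_ge0 a; lra.
(* One summand for each of [E1] to [E4], in this order. *)
exists (8 * a ^+ 2 * C + 8 * a * K1 + 12 * a * (a + 1) * K2
    + 8 * a ^+ 2 * C).
  have := mulr_ge0 a_ge0 K1_ge0; have := mulr_ge0 a_ge0 K2_ge0.
  have := mulr_ge0 a_ge0 ac.
  have := mulr_ge0 a_ge0 (mulr_ge0 a_ge0 K2_ge0).
  lra.
move=> k; have := qK1 k.+1; have := NS_ge2 k.
rewrite [var_err k.+2]/var_err v_step -/(q k.+1) (NS k.+1) /var_err.
move: (N k.+1) (q k.+1) (v k.+1) => x y u x2.
set L := ln x; set r := y - _ - _ => rK1.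
have /andP[] := @ln_increment _ x ltac:(lra); rewrite -/L.
have -> : ln (x + 1) = L + (ln (x + 1) - L) by ring.
set dl := ln (x + 1) - L; rewrite addrAC subrr add0r => d1 d2.
have L0 : 0 <= L by apply: ln_ge0; lra.
have Lx : L <= x by apply/ltW/ln_sublinear; lra.
have xV : x * x^-1 = 1 by apply: divff; lra.
have zV : (x + 1) * (x + 1)^-1 = 1 by apply: divff; lra.
have z0 : 0 < (x + 1)^-1 by rewrite invr_gt0; lra.
have xVz : x^-1 <= 2 * (x + 1)^-1.
  by rewrite -ler_pdivrMr // invrK -[x^-1]mul1r mulrAC ler_pdivrMr; lra.
(* With dl the increment of ln, L dl and dl replace ln N / N and 1 / N up to
   terms of order 1 / N, which dl dominates; E1-E4 treat the four errors. *)
have E1 : `|8 * a ^+ 2 * c * (L * (x^-1 - dl))| <= 8 * a ^+ 2 * C * dl.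
  rewrite normrM [`|_ * c|]normrM -/C [`|8 * _|]ger0_norm ?mulr_ge0 ?sqr_ge0 //.
  rewrite ler_wpM2l ?mulr_ge0 ?sqr_ge0 // ger0_norm.
    (* Since [L <= x], the product is at most [x (1 / x - 1 / (x + 1)) = 1 / (x + 1) <= dl]. *)
    apply: le_trans (_ : x * (x^-1 - (x + 1)^-1) <= _).
      by apply: ler_pM => //; lra.
    by nra.
  by rewrite mulr_ge0 //; lra.
have E2 : `|4 * a * (r / x)| <= 8 * a * K1 * dl.
  rewrite normrM ger0_norm ?mulr_ge0 //.
  have -> : 8 * a * K1 * dl = 4 * a * (K1 * (2 * dl)) by ring.
  rewrite ler_wpM2l ?mulr_ge0 // normrM ler_pM //.
  by rewrite ger0_norm ?invr_ge0; lra.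
have yE : `|y| <= K2 * x.
  have -> : y = r + ((a ^+ 2 + a) * x + 2 * a * c * L) by rewrite /r; ring.
  apply: le_trans (ler_normD _ _) _.
  apply: le_trans (lerD rK1 (ler_normD _ _)) _.
  rewrite [`|(_ + _) * x|]ger0_norm; last first.
    by rewrite mulr_ge0 ?addr_ge0 ?sqr_ge0 //; lra.
  rewrite [`|_ * L|]normrM [`|2 * a * c|]normrM -/C.
  rewrite [`|2 * a|]ger0_norm ?mulr_ge0 // [`|L|]ger0_norm //.
  have : 2 * a * C * L <= 2 * a * C * x by rewrite ler_wpM2l ?mulr_ge0.
  by rewrite /K2; nra.
have E3 : `|4 * a * (a - 1) * (y / (x * (x - 1)))| <= 12 * a * (a + 1) * K2 * dl.
  have -> : 12 * a * (a + 1) * K2 * dl = 4 * a * (a + 1) * (K2 * (3 * dl)) by ring.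
  rewrite normrM; apply: ler_pM => //.
    rewrite normrM ger0_norm ?mulr_ge0 // ler_wpM2l ?mulr_ge0 //.
    by rewrite ler_norml; lra.
  rewrite normrM [`|_^-1|]ger0_norm; last by rewrite invr_ge0 mulr_ge0; lra.
  apply: le_trans (_ : K2 * (x - 1)^-1 <= _).
    rewrite ler_pdivrMr; last by rewrite mulr_gt0; lra.
    have -> : K2 / (x - 1) * (x * (x - 1)) = K2 * x by field; lra.
    exact: yE.
  (* [1 / (x - 1) <= 3 / (x + 1)] holds exactly because [x >= 2]. *)
  rewrite ler_wpM2l //; apply: le_trans (_ : 3 * (x + 1)^-1 <= _); last by lra.
  by rewrite -ler_pdivrMr // invrK -[(x - 1)^-1]mul1r mulrAC ler_pdivrMr; lra.
have E4 : `|4 * a ^+ 2 * c * dl ^+ 2| <= 8 * a ^+ 2 * C * dl.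
  rewrite normrM [`|_ * c|]normrM -/C [`|4 * _|]ger0_norm ?mulr_ge0 ?sqr_ge0 //.
  have -> : 8 * a ^+ 2 * C * dl = 4 * a ^+ 2 * C * (2 * dl) by ring.
  rewrite ler_wpM2l ?mulr_ge0 ?sqr_ge0 // ger0_norm ?sqr_ge0 //.
  have : x^-1 <= 1 by rewrite invf_le1; lra.
  by nra.
(* Uses [(x - a) / (x (x - 1)) = 1 / x - (a - 1) / (x (x - 1))], the expansion of [y] with remainder
   [r], and [2 L dl + dl^2] as increment of the squared logarithm. *)
rewrite [X in `|X|](_ : _ = 8 * a ^+ 2 * c * (L * (x^-1 - dl)) + 4 * a * (r / x)
   - 4 * a * (a - 1) * (y / (x * (x - 1))) - 4 * a ^+ 2 * c * dl ^+ 2); last first.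
  by rewrite /r; field; lra.
apply: le_trans (ler_normB _ _) _; apply: le_trans (lerD (ler_normB _ _) E4) _.
apply: le_trans (lerD (lerD (ler_normD _ _) E3) (lexx _)) _.
lra.
Qed.

(** Passes from the node count [N] to the time [n]: [N = n + m0 - 1] and
    [0 <= ln N - ln n <= ln m0], so the squared logarithms differ by [O(ln n)] plus a constant. *)
Lemma variance_asymptotics : exists C1 : R, exists2 C2 : R, 0 <= C2 &
  forall k, `|v k.+1 - 4 * a ^+ 2 * (a + 1) * k.+2%:R
              - 4 * a ^+ 2 * c * ln k.+2%:R ^+ 2| <= C1 + C2 * ln k.+2%:R.
Proof.
have a0 := a_ge0; have [K K_ge0 stepK] := var_err_step.
pose l0 : R := ln m0%:R.
have l0_ge0 : 0 <= l0 by apply: ln_ge0; rewrite ler1n.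
have ac : 0 <= 4 * a ^+ 2 * C * l0 by rewrite !mulr_ge0 ?sqr_ge0.
exists (`|var_err 1| + K * l0 + 4 * a ^+ 2 * (a + 1) * m0%:R
   + 4 * a ^+ 2 * C * l0 * l0).
exists (K + 4 * a ^+ 2 * C * l0 * 2); first by lra.
move=> k; set n : R := k.+2%:R.
have n1 : 1 <= n by rewrite ler1n.
have Nn : N k.+1 = n + m0%:R - 1 by rewrite /N /n -[in RHS]natr1 natrD; ring.
have M1 : 1 <= m0%:R :> R by rewrite ler1n.
have lNn : ln n <= ln (N k.+1) by rewrite ler_ln ?posrE ?Nn; lra.
(* [n + m0 - 1 <= n m0], as both factors are at least 1. *)
have lNM : ln (N k.+1) <= ln n + l0.
  have nM : 0 < n * m0%:R by rewrite mulr_gt0; lra.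
  rewrite -lnM ?posrE; [|lra|lra].
  by rewrite ler_ln ?posrE // ?Nn; nra.
have ln0 : 0 <= ln n by apply: ln_ge0.
have EK : `|var_err k.+1| <= `|var_err 1| + K * ln (N k.+1).
  have -> : var_err k.+1 = (var_err k.+1 - var_err 1) + var_err 1 by ring.
  apply: le_trans (ler_normD _ _) _; rewrite addrC lerD2l.
  have h j : `|var_err j.+2 - var_err j.+1| <=
      K * ln (N j.+2) - K * ln (N j.+1) by rewrite -mulrBr.
  apply: le_trans (@telescope_bound _ (fun j => var_err j.+1)
    (fun j => K * ln (N j.+1)) h k) _.
  have : 0 <= ln (N 1) by apply: ln_ge0.
  by nra.
have -> : v k.+1 - 4 * a ^+ 2 * (a + 1) * n - 4 * a ^+ 2 * c * ln n ^+ 2 =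
    var_err k.+1 + 4 * a ^+ 2 * (a + 1) * (m0%:R - 1)
    + 4 * a ^+ 2 * c * ((ln (N k.+1) - ln n) * (ln (N k.+1) + ln n)).
  by rewrite /var_err Nn; ring.
apply: le_trans (ler_normD _ _) _; rewrite -/l0.
have EB : `|4 * a ^+ 2 * (a + 1) * (m0%:R - 1)| <= 4 * a ^+ 2 * (a + 1) * m0%:R.
  rewrite ger0_norm; first by rewrite ler_wpM2l ?mulr_ge0 ?sqr_ge0 //; lra.
  by rewrite !mulr_ge0 ?sqr_ge0 //; lra.
have EC : `|4 * a ^+ 2 * c * ((ln (N k.+1) - ln n) * (ln (N k.+1) + ln n))| <=
    4 * a ^+ 2 * C * (l0 * (l0 + 2 * ln n)).
  rewrite normrM [`|_ * c|]normrM -/C [`|4 * _|]ger0_norm ?mulr_ge0 ?sqr_ge0 //.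
  rewrite ler_wpM2l ?mulr_ge0 ?sqr_ge0 // ger0_norm; last by rewrite mulr_ge0; lra.
  by rewrite ler_pM; lra.
apply: le_trans (lerD (ler_normD _ _) EC) _.
have := ler_wpM2l K_ge0 lNM.
lra.
Qed.

End Asymptotics.

(** * The variance expansion for the network *)

Theorem corollary1 (R : realType) (d : measure_display) (T : measurableType d)
    (P : probability T R) (m0 m : nat)
    (hm0 : (1 <= m0)%N) (hm : (1 <= m <= m0)%N)
    (S : forall k, T -> {set 'I_(k + m0)})
    (hS : uniform_attachment P m S) :
  exists2 e : nat -> R,
    e =O_\oo (fun n => ln (n%:R : R)) &
    forall n : nat, (1 <= n)%N ->
      'V_P[Z S n] =
        (4 * m%:R ^+ 2 * (m%:R + 1) * n%:R
         + 4 * m%:R ^+ 2 * m0%:R * (m0%:R - 2 * m%:R - 1) * ln n%:R ^+ 2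
         + e n)%:E.
Proof.
have /andP[_ m_le] := hm.
pose c : R := m0%:R * (m0%:R - 2 * m%:R - 1).
have meanS k : mean_zagreb P S k.+1 = mean_zagreb P S k + (2 * m%:R *
    ((2 * m%:R * (k + m0)%:R + c) / (k + m0)%:R) + m%:R + m%:R ^+ 2).
  by rewrite (mean_zagreb_step hm0 m_le hS) total_degE.
have varS k : var_zagreb P S k.+1 = var_zagreb P S k +
    4 * m%:R * ((k + m0)%:R - m%:R) / ((k + m0)%:R * ((k + m0)%:R - 1)) *
    (mean_zagreb P S k - (2 * m%:R * (k + m0)%:R + c) ^+ 2 / (k + m0)%:R).
  by rewrite (var_zagreb_step hm0 m_le hS) total_degE.
have [C1 [C2 C2_ge0 bound]] :=
  variance_asymptotics hm0 (ler0n R m) meanS varS.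
(* The error is defined as the difference, so only its order remains to be bounded. *)
exists (fun n => var_zagreb P S n.-1 - 4 * m%:R ^+ 2 * (m%:R + 1) * n%:R
    - 4 * m%:R ^+ 2 * c * ln n%:R ^+ 2); last first.
  by move=> n _; rewrite (variance_Z hS) /c; congr EFin; ring.
have ln2_gt0 : 0 < ln 2 :> R by rewrite ln_gt0 // ltr1n.
(* From [n = 2] on, [ln n >= ln 2 > 0], so the constant [C1] is absorbed into a multiple of [ln n];
   the summand 1 makes the factor positive. *)
apply/eqO_exP; exists (`|C1| / ln 2 + C2 + 1).
  by rewrite ltr_wpDl ?addr_ge0 ?divr_ge0 // ltW.
exists 2%N => // -[|[|k]] //= _; apply: le_trans (bound k) _.
have lnk : ln 2 <= ln k.+2%:R :> R by rewrite ler_ln ?posrE ?ler_nat.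
have ln_ge0k : 0 <= ln k.+2%:R :> R by apply: le_trans lnk; exact: ltW.
have : C1 <= `|C1| / ln 2 * ln k.+2%:R.
  apply: le_trans (ler_norm _) _; rewrite mulrAC ler_pdivlMr //.
  exact: ler_wpM2l.
by rewrite (ger0_norm ln_ge0k) !mulrDl mul1r; lra.
Qed.
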